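(* Let $F$ be a finite set of nonnegative integers. Then, as polynomials in $x$, $$\mathtt{H}_{F,x}=i^{\,w_F}\,\mathtt{H}_{I(F),-ix},$$ where $i=\sqrt{-1}$ is the imaginary unit.
   Context: The Hermite polynomials are $$H_n(x)=n!\sum_{j=0}^{\lfloor n/2\rfloor}\frac{(-1)^j(2x)^{n-2j}}{j!(n-2j)!},\qquad n\ge 0.$$ For a finite set $F=\{f_1<f_2<\cdots<f_k\}$ of nonnegative integers define: - the normalized Wronskian $$\mathtt{H}_{F,x}=\frac{1}{2^{\binom{k}{2}}\prod_{f\in F}f!}\det\big(H_{f_r}^{(j-1)}(x)\big)_{r,j=1}^k,$$ where $H^{(j-1)}$ denotes the $(j-1)$-th derivative; $\mathtt{H}_{I(F),-ix}$ denotes the polynomial $\mathtt{H}_{I(F),y}$ evaluated at $y=-ix$ (and the number of elements of $I(F)$ is used in place of $k$ in its definition); - $w_F=\sum_{f\in F}f-\binom{k}{2}$; - $I(F)=\{0,1,2,\dots,\max F\}\setminus\{\max F-f: f\in F\}$. Conventions: the determinant of an empty matrix is $1$; $\max\emptyset=-1$, so that $I(\emptyset)=\emptyset$. *)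

(* Defs.v *)
From HB Require Import structures.
From mathcomp Require Import all_boot all_order all_algebra finmap.

Set Implicit Arguments.
Unset Strict Implicit.
Unset Printing Implicit Defensive.

Import Order.TTheory GRing.Theory Num.Theory.
Local Open Scope ring_scope.
Local Open Scope fset_scope.

Definition hermite (K : numFieldType) (n : nat) : {poly K} :=
  n`!%:R *: \sum_(j < n./2.+1)
    ((-1) ^+ j / (j`!%:R * (n - j.*2)`!%:R)) *: (2%:R *: 'X) ^+ (n - j.*2).

(* f_1 < f_2 < ... < f_k, indexed from 0. *)
Definition increasing_enum (F : {fset nat}) : seq nat :=
  sort leq (enum_fset F).

(* Row and column indices start at 0, so column j carries the j-th (rather
   than the (j-1)-th) derivative. For F empty this is the 0 x 0 determinant,
   which is 1. *)
Definition hermite_wronskian_mx (K : numFieldType) (F : {fset nat}) :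
    'M[{poly K}]_#|` F| :=
  \matrix_(r < #|` F|, j < #|` F|)
    (hermite K (nth 0%N (increasing_enum F) r))^`(j).

Definition normalized_wronskian (K : numFieldType) (F : {fset nat}) : {poly K} :=
  (2%:R ^+ 'C(#|` F|, 2) * \prod_(f <- F) f`!%:R)^-1
    *: \det (hermite_wronskian_mx K F).

(* Computed in int, so that the subtraction is not truncated. *)
Definition weight (F : {fset nat}) : int :=
  (\sum_(f <- F) f)%N%:Z - 'C(#|` F|, 2)%:Z.

(* 1 + max F, as a natural number; it is 0 for F empty, in accordance with the
   convention max fset0 = -1. *)
Definition succ_max (F : {fset nat}) : nat := (\max_(f <- F) f.+1)%N.

(* {0, ..., max F} minus {max F - f : f in F}; since max F = succ_max F - 1,
   the number max F - f is succ_max F - f.+1, never truncated for f in F. *)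
Definition involution (F : {fset nat}) : {fset nat} :=
  [fset m in iota 0 (succ_max F)] `\` [fset (succ_max F - f.+1)%N | f in F].

(* Main.v *)
Require Import Defs.
From HB Require Import structures.
From mathcomp Require Import all_boot all_order all_algebra finmap.
From mathcomp Require Import perm zify ring.
Import Order.TTheory GRing.Theory Num.Theory.
Local Open Scope ring_scope.

(** Write [h_n = H_n / n!] and [h_n = 0] for [n < 0].  Since [h_n' = 2 h_(n-1)],
    dividing out the factorials and the powers of 2 turns the normalized
    Wronskian into the determinant of the [h_(f_r - j)]
    ([normalized_wronskianE]).  This is the minor of the infinite
    upper-triangular Toeplitz matrix [T(h) = (h_(b-a))_(a,b)] on its first [k]
    rows and the columns in [F], and the identity is the duality between
    complementary minors of [T(h)] and of its inverse: the dual Jacobi-Trudi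
    identity for the partition that [F] encodes.

    The inverse is explicit.  The [h_n] have the generating function
    [E(t) = exp (2xt - t^2)], and replacing [(x, t)] by [(-ix, -it)] changes it
    into [exp (-2xt + t^2) = 1 / E(t)].  So [g_n = (-i)^n h_n(-ix)] is the
    convolution inverse of [h] ([nhermite_convolution]) and [T(g)] is inverse to
    [T(h)].  No power series are needed: the three-term recurrences
    [n h_n = 2x h_(n-1) - 2 h_(n-2)] and [n g_n = -2x g_(n-1) + 2 g_(n-2)] give
    [n c_n = 0] for the convolution [c] of [h] and [g].

    With [N = max F + 1], truncate both matrices to size [N] and list the indices
    as [F] followed by its complement.  Jacobi's theorem
    ([complementary_minor]) expresses the minor of [T(h)] through the minor of
    [T(g)] with rows outside [F] and columns [k, ..., N-1], up to the sign of
    the shuffle, which is [(-1)^w] for the weight [w] of [F]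
    ([det_unitriangular_shuffle]).  The reflection [a |-> N-1-a] makes the
    complement of [F] into [I(F)] and that minor into the determinant of the
    [g_(m_r - j)].  Extracting the powers of [-i] from it leaves
    [(-i)^(w(I(F)))] ([dual_nhermite_minor]); as [w(I(F)) = w(F)]
    ([weight_involution]), the total factor is [(-1)^w (-i)^w = i^w]. *)

(** * Determinants and complementary minors *)

Section Det.
Variable R : comNzRingType.

Lemma det_scale k (c d : nat -> R) (M : nat -> nat -> R) :
  \det (\matrix_(r < k, j < k) (c r * M r j * d j)) =
  (\prod_(r < k) c r) * (\prod_(j < k) d j) * \det (\matrix_(r < k, j < k) M r j).
Proof.
transitivity (\det (diag_mx (\row_r c (nat_of_ord r)) *m
   (\matrix_(r < k, j < k) M r j) *m diag_mx (\row_j d (nat_of_ord j)))).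
  by congr (\det _); apply/matrixP=> r j; rewrite mul_mx_diag mul_diag_mx !mxE.
rewrite !det_mulmx !det_diag mulrAC.
by congr (_ * _ * _); apply: eq_bigr => r _; rewrite mxE.
Qed.

Lemma det_rev k (M : nat -> nat -> R) :
  \det (\matrix_(r < k, j < k) M (k - r.+1)%N (k - j.+1)%N) =
  \det (\matrix_(r < k, j < k) M r j).
Proof.
set A := (X in _ = \det X); pose s := perm (@rev_ord_inj k).
have -> : \matrix_(r < k, j < k) M (k - r.+1)%N (k - j.+1)%N = row_perm s (col_perm s A).
  by apply/matrixP=> r j; rewrite !mxE !permE.
rewrite row_permE col_permE !det_mulmx !det_perm odd_permV mulrC -mulrA.
by rewrite -signr_addb addbb mulr1.
Qed.

(** Jacobi's theorem on complementary minors of inverse matrices.  Replacing the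
    left block column of [B] by that of the identity keeps the product with [A]
    block triangular, with the minor of [A] and 1 on its diagonal. *)
Lemma complementary_minor k m (A B : 'M[R]_(k + m)) :
  A *m B = 1%:M -> \det (ulsubmx A) = \det A * \det (drsubmx B).
Proof.
move=> AB1.
have -> : \det (drsubmx B) = \det (block_mx 1%:M (ursubmx B) 0 (drsubmx B)).
  by rewrite det_ublock det1 mul1r.
rewrite -det_mulmx -{2}[A]submxK mulmx_block !mulmx1 !mulmx0 !addr0.
have : block_mx (ulsubmx A) (ursubmx A) (dlsubmx A) (drsubmx A) *m
       block_mx (ulsubmx B) (ursubmx B) (dlsubmx B) (drsubmx B) = block_mx 1%:M 0 0 1%:M.
  by rewrite !submxK AB1 -scalar_mx_block.
rewrite mulmx_block => /eq_block_mx [_ -> _ ->].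
by rewrite det_lblock det1 mulr1.
Qed.

Lemma nth_bump (s1 s2 : seq nat) x j :
  nth 0%N (s1 ++ x :: s2) (bump (size s1) j) = nth 0%N (s1 ++ s2) j.
Proof.
rewrite /bump !nth_cat; case: (leqP (size s1) j) => h /=.
  by rewrite ifF ?subSn //; lia.
by rewrite add0n h.
Qed.

(** Only the entry in the column of [n] survives in the last row, so the
    determinant expands into the one where [n] is deleted from the list. *)
Lemma det_unitriangular_insert (a : nat -> nat -> R) n (s1 s2 : seq nat) :
  a n n = 1 -> {in s1 ++ s2, forall j, a n j = 0} -> size (s1 ++ s2) = n ->
  \det (\matrix_(i < n.+1, j < n.+1) a i (nth 0%N (s1 ++ n :: s2) j)) =
  (-1) ^+ (n + size s1) * \det (\matrix_(i < n, j < n) a i (nth 0%N (s1 ++ s2) j)).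
Proof.
move=> ann a0 sz.
have ks : (size s1 < n.+1)%N by move: sz; rewrite size_cat; lia.
pose p := Ordinal ks.
rewrite (expand_det_row _ ord_max) (bigD1 p) //= big1 ?addr0 => [|j]; last first.
  rewrite eq_sym => /unlift_some[j' -> _]; rewrite !mxE /= nth_bump a0 ?mul0r //.
  by rewrite mem_nth // sz.
rewrite !mxE /= nth_cat ltnn subnn /= ann mul1r; congr (_ * \det _).
apply/matrixP=> i j; rewrite !mxE /= nth_bump /bump.
by rewrite leqNgt ltn_ord add0n.
Qed.

(** The determinant is the sign of the permutation that lists the indices
    satisfying [p] first.  Adding a largest index [n] to the first part moves it
    across all of the second part, while the exponent grows by [n] plus the
    size of the first part, which has the same parity. *)
Lemma det_unitriangular_shuffle (a : nat -> nat -> R) (p : pred nat) n :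
  (forall i, a i i = 1) -> (forall i j, (j < i)%N -> a i j = 0) ->
  let s := filter p (iota 0 n) in
  \det (\matrix_(i < n, j < n) a i (nth 0%N (s ++ filter (predC p) (iota 0 n)) j)) =
  (-1) ^+ (\sum_(f <- s) f + 'C(size s, 2)).
Proof.
move=> a1 a0 /=; elim: n => [|n IHn]; first by rewrite big_nil det_mx00.
rewrite -[n.+1]addn1 iotaD !filter_cat add0n /= addn1.
set s := filter p _ in IHn *; set t := filter (predC p) _ in IHn *.
have st_small : {in s ++ t, forall j, a n j = 0}.
  move=> j; rewrite mem_cat !mem_filter mem_iota add0n => h; apply: a0; lia.
have size_st : size (s ++ t) = n.
  by rewrite size_cat !size_filter count_predC size_iota.
case: (p n) => /=.
  rewrite cats0 -catA det_unitriangular_insert // IHn -exprD.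
  rewrite big_cat big_seq1 size_cat /= addn1 binS bin1.
  by congr (_ ^+ _); rewrite /=; lia.
rewrite cats0 catA det_unitriangular_insert ?cats0 // IHn size_st.
by rewrite -signr_odd oddD addbb mul1r.
Qed.

(** * Toeplitz matrices and convolution inverses *)

Definition toeplitz (h : nat -> R) (i j : nat) : R :=
  if (i <= j)%N then h (j - i)%N else 0.

Definition convolution (h g : nat -> R) (n : nat) : R :=
  \sum_(i < n.+1) h i * g (n - i)%N.

Lemma toeplitz_inverse (h g : nat -> R) n i j :
  (forall m, convolution h g m = (m == 0%N)%:R) -> (j < n)%N ->
  \sum_(0 <= l < n) toeplitz h i l * toeplitz g l j = (i == j)%:R.
Proof.
move=> hg jn; case: (leqP i j) => [ij|ji]; last first.
  rewrite gtn_eqF // big1_seq // => l _; rewrite /toeplitz.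
  by case: (leqP i l) => il; rewrite ?mul0r // [(l <= j)%N]leqNgt (leq_trans ji il) mulr0.
rewrite (big_cat_nat (n := i)) ?(leq_trans ij (ltnW jn)) //=.
rewrite big_nat big1 ?add0r => [|l /andP[_ li]]; last first.
  by rewrite /toeplitz leqNgt li mul0r.
rewrite (big_cat_nat (n := j.+1)) ?(leq_trans ij (leqnSn j)) //=.
rewrite [X in _ + X]big_nat [X in _ + X]big1 ?addr0 => [|l /andP[jl _]]; last first.
  by rewrite /toeplitz [(l <= j)%N]leqNgt jl mulr0.
rewrite -{1}[i]add0n big_addn subSn // big_mkord.
transitivity (convolution h g (j - i)%N); last by rewrite hg; congr (nat_of_bool _)%:R; lia.
apply: eq_bigr => l _; have := ltn_ord l => hl.
rewrite /toeplitz leq_addl addnK ifT; last by lia.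
by congr (_ * g _); lia.
Qed.

(** The Toeplitz matrix of [g] inverts that of [h], so permuting the columns of
    the latter and the rows of the former by the same listing [s ++ t] of the
    indices keeps them inverse to each other, and Jacobi's theorem applies to
    the leading block of size [size s]. *)
Lemma dual_toeplitz_minor (h g : nat -> R) (p : pred nat) n :
  (forall m, convolution h g m = (m == 0%N)%:R) -> h 0%N = 1 ->
  let s := filter p (iota 0 n) in let t := filter (predC p) (iota 0 n) in
  \det (\matrix_(i < size s, j < size s) toeplitz h i (nth 0%N s j)) =
  (-1) ^+ (\sum_(f <- s) f + 'C(size s, 2)) *
  \det (\matrix_(i < size t, j < size t)
     toeplitz g (nth 0%N t i) (size s + j)).
Proof.
move=> hg h0 s t.
have h_diag i : toeplitz h i i = 1 by rewrite /toeplitz leqnn subnn.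
have h_low i j : (j < i)%N -> toeplitz h i j = 0 by rewrite /toeplitz ltnNge; case: leqP.
have <- := det_unitriangular_shuffle _ p n h_diag h_low.
rewrite -/s -/t.
have size_st : size (s ++ t) = n.
  by rewrite size_cat !size_filter count_predC size_iota.
have perm_st : perm_eq (s ++ t) (iota 0 n) by rewrite perm_filterC.
have inv i j : (j < n)%N ->
    \sum_(l < n) toeplitz h i (nth 0%N (s ++ t) l) *
                 toeplitz g (nth 0%N (s ++ t) l) j = (i == j)%:R.
  move=> jn; rewrite -(toeplitz_inverse h g n) // /index_iota subn0.
  rewrite -(perm_big _ perm_st) /=.
  by rewrite (big_nth 0%N) size_st big_mkord.
move: inv; rewrite -size_st size_cat => inv.
set A := (X in _ = \det X * _).
pose B := \matrix_(i < size s + size t, j < size s + size t)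
     toeplitz g (nth 0%N (s ++ t) i) j.
have -> : \matrix_(i < size s, j < size s) toeplitz h i (nth 0%N s j) = ulsubmx A.
  by apply/matrixP=> i j; rewrite !mxE /= nth_cat ltn_ord.
rewrite (complementary_minor _ _ _ B).
  congr (_ * \det _); apply/matrixP=> i j; rewrite !mxE /= nth_cat.
  by rewrite ltnNge leq_addr /= addKn.
apply/matrixP=> i j; rewrite !mxE -[RHS]inv ?ltn_ord //.
by apply: eq_bigr => l _; rewrite !mxE.
Qed.

(** Multiplication by [t] of the generating function: it lets a three-term
    recurrence be stated at all indices, without exceptions at 0 and 1. *)
Definition shift (h : nat -> R) (n : nat) : R := if n is m.+1 then h m else 0.

Lemma convolution_shift h g n :
  convolution (shift h) g n = convolution h (shift g) n.
Proof.
rewrite /convolution big_ord_recl big_ord_recr /= subnn mul0r mulr0 add0r addr0.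
apply: eq_bigr => i _; rewrite /bump add1n subnS.
by case: (n - i)%N (subn_gt0 i n) => //=; rewrite ltn_ord.
Qed.

(** The hypotheses say that the generating functions satisfy [h' = (a + b t) h]
    and [g' = - (a + b t) g], up to the factor [t] of [t d/dt]; so the
    logarithmic derivatives cancel and [h g] has derivative 0. *)
Lemma convolution_eq0 (h g : nat -> R) (a b : R) n :
  (forall m, m%:R * h m = a * shift h m + b * shift (shift h) m) ->
  (forall m, m%:R * g m = - a * shift g m - b * shift (shift g) m) ->
  n%:R * convolution h g n = 0.
Proof.
move=> hh hg.
transitivity (a * convolution (shift h) g n + b * convolution (shift (shift h)) g n
  - a * convolution h (shift g) n - b * convolution h (shift (shift g)) n); last first.
  by rewrite !convolution_shift; ring.
rewrite /convolution !mulr_sumr -!sumrN -!big_split /=; apply: eq_bigr => i _.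
(* Write the leading [n] as [i + (n - i)], one part for each factor. *)
rewrite -{1}(subnKC (ltn_ord i : i <= n)%N) natrD mulrDl mulrA hh.
rewrite [_ * (h i * _)]mulrCA hg; ring.
Qed.

End Det.

Arguments toeplitz {R}.
Arguments convolution {R}.
Arguments shift {R}.

(** * Normalized Hermite polynomials *)

Section Herm.
Variable K : numFieldType.

Definition nhermite (n : nat) : {poly K} := n`!%:R^-1 *: hermite K n.

Lemma fact_neq0 n : n`!%:R != 0 :> K.
Proof. by rewrite pnatr_eq0 -lt0n fact_gt0. Qed.

(** The coefficient of [x^m t^(m + 2j)] in [exp (2xt - t^2)]. *)
Definition nhermite_coef (j m : nat) : K :=
  (-1) ^+ j * 2%:R ^+ m / (j`!%:R * m`!%:R).

Lemma coef_nhermite n m : (nhermite n)`_m =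
  if (m <= n)%N && ~~ odd (n - m) then nhermite_coef (n - m)./2 m else 0.
Proof.
rewrite /nhermite /hermite scalerA mulVf ?fact_neq0 // scale1r coef_sum.
have term (j : 'I_n./2.+1) :
  (((-1) ^+ j / (j`!%:R * (n - j.*2)`!%:R)) *: (2%:R *: 'X) ^+ (n - j.*2) : {poly K})`_m =
  if m == (n - j.*2)%N then nhermite_coef j m else 0.
  rewrite exprZn scalerA coefZ coefXn; case: eqP => [->|_]; last by rewrite mulr0.
  by rewrite mulr1 mulrAC.
rewrite (eq_bigr _ (fun j _ => term j)) -big_mkcond /=.
case: ifP => [/andP[mn nm_even]|no].
  have jn : ((n - m)./2 < n./2.+1)%N by lia.
  rewrite (big_pred1 (Ordinal jn)) // => j; rewrite /= -val_eqE /=.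
  by have := ltn_ord j; lia.
by rewrite big_pred0 // => j; have := ltn_ord j; lia.
Qed.

Lemma coef_nhermiteD j m : (nhermite (j.*2 + m))`_m = nhermite_coef j m.
Proof. by rewrite coef_nhermite leq_addl addnK odd_double doubleK. Qed.

Lemma nhermite_coef_succ_deg j m :
  m.+1%:R * nhermite_coef j m.+1 = 2%:R * nhermite_coef j m.
Proof.
rewrite /nhermite_coef factS natrM exprS; field.
by rewrite !fact_neq0 ?natr1 ?nat1r pnatr_eq0.
Qed.

Lemma nhermite_coef_succ_step j m :
  j.+1%:R * nhermite_coef j.+1 m = - nhermite_coef j m.
Proof.
rewrite /nhermite_coef factS natrM exprS; field.
by rewrite !fact_neq0 ?natr1 ?nat1r pnatr_eq0.
Qed.

Lemma deriv_nhermite n : (nhermite n)^`() = 2%:R * shift nhermite n.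
Proof.
apply/polyP=> m; rewrite coef_deriv -polyC_natr coefCM -[_ *+ m.+1]mulr_natl.
case: n => [|n] /=; first by rewrite coef0 coef_nhermite /= !mulr0.
rewrite !coef_nhermite ltnS subSS; case: ifP => _; last by rewrite !mulr0.
exact: nhermite_coef_succ_deg.
Qed.

(** Comparing coefficients: in degree [m] of [h_(m + 2j)], the factor [m + 2j]
    splits into [m], accounted for by [x h_n' = 2x h_(n-1)], and [2j], accounted
    for by [- 2 h_(n-2)]. *)
Lemma nhermite_rec n : n%:R * nhermite n =
  (2%:R *: 'X) * shift nhermite n + (- 2%:R) * shift (shift nhermite) n.
Proof.
have -> : (2%:R *: 'X) * shift nhermite n = 'X * (nhermite n)^`().
  by rewrite deriv_nhermite -polyC_natr mulrCA -mul_polyC mulrA.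
apply/polyP=> m.
rewrite -polyC_natr mulNr -polyC_natr coefD coefN !coefCM coefXM coef_deriv.
have -> : (if m == 0%N then 0 else (nhermite n)`_m.-1.+1 *+ m.-1.+1) =
  m%:R * (nhermite n)`_m by case: m => [|m] /=; rewrite ?mul0r // mulr_natl.
case: (boolP ((m <= n)%N && ~~ odd (n - m))) => [/andP[mn nm_even]|no].
  have -> : n = ((n - m)./2.*2 + m)%N by lia.
  move: (n - m)./2 => [|j].
    rewrite add0n; suff -> : (shift (shift nhermite) m)`_m = 0 by ring.
    by case: m {mn nm_even} => [|[|m]] /=; rewrite ?coef0 // coef_nhermite ltnNge leqnSn.
  rewrite coef_nhermiteD doubleS !addSn /= coef_nhermiteD -[nhermite_coef j m]opprK.
  by rewrite -nhermite_coef_succ_step -!addSn -doubleS natrD -muln2 natrM; ring.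
suff -> : (shift (shift nhermite) n)`_m = 0.
  by rewrite coef_nhermite (negbTE no); ring.
case: n no => [|[|n]] /= no; rewrite ?coef0 // coef_nhermite ifF //.
by move: no; lia.
Qed.

Lemma nhermite0 : nhermite 0 = 1.
Proof.
apply/polyP => -[|m]; rewrite coef_nhermite coef1 //=.
by rewrite /nhermite_coef !expr0 !fact0 !mulr1 divr1.
Qed.

Lemma derivn_nhermite n j :
  (nhermite n)^`(j) = 2%:R ^+ j * toeplitz nhermite j n.
Proof.
elim: j n => [|j IHj] n; first by rewrite derivn0 mul1r /toeplitz subn0.
rewrite derivSn deriv_nhermite.
case: n => [|n] /=; first by rewrite mulr0 linear0 /toeplitz mulr0.
rewrite -polyC_natr mul_polyC derivnZ IHj -mul_polyC polyC_natr mulrA exprS.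
by rewrite /toeplitz ltnS subSS.
Qed.

(** As [H_f^(j) = f! 2^j h_(f - j)], the factor [f!] comes out of the row of [f]
    and [2^j] out of column [j]; they are the normalization. *)
Lemma normalized_wronskianE (F : {fset nat}) :
  normalized_wronskian K F =
  let s := increasing_enum F in
  \det (\matrix_(i < size s, j < size s) toeplitz nhermite i (nth 0%N s j)).
Proof.
set s := increasing_enum F => /=.
have size_s : size s = #|` F| by rewrite size_sort cardfE.
rewrite /normalized_wronskian /hermite_wronskian_mx -/s -size_s.
have -> : \matrix_(r < size s, j < size s) (hermite K (nth 0%N s r))^`(j) =
  \matrix_(r < size s, j < size s)
    ((nth 0%N s r)`!%:R%:P * toeplitz nhermite j (nth 0%N s r) * (2%:R ^+ j)%:P).
  apply/matrixP=> r j; rewrite !mxE -mulrA [toeplitz _ _ _ * _]mulrC.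
  rewrite polyC_exp (polyC_natr _ 2).
  rewrite -derivn_nhermite mul_polyC -derivnZ /nhermite scalerA divff ?fact_neq0 //.
  by rewrite scale1r.
rewrite (det_scale _ _ (fun r => (nth 0%N s r)`!%:R%:P) (fun j => (2%:R ^+ j)%:P)
  (fun r j => toeplitz nhermite j (nth 0%N s r))).
have -> : \prod_(r < size s) (nth 0%N s r)`!%:R%:P = (\prod_(f <- F) f`!%:R)%:P :> {poly K}.
  rewrite -(big_mkord xpredT (fun r => (nth 0%N s r)`!%:R%:P)).
  rewrite -(big_nth 0%N xpredT (fun f => f`!%:R%:P)).
  by rewrite (perm_big F) ?perm_sort // rmorph_prod.
have -> : \prod_(j < size s) (2%:R ^+ j)%:P = (2%:R ^+ 'C(size s, 2))%:P :> {poly K}.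
  by rewrite -rmorph_prod -expr_sum -bin2_sum big_mkord.
rewrite -polyCM mul_polyC scalerA [X in X^-1]mulrC mulVf ?scale1r; last first.
  rewrite mulf_neq0 ?expf_neq0 ?pnatr_eq0 //.
  by rewrite prodf_seq_neq0; apply/allP => f _; exact: fact_neq0.
rewrite -det_tr; congr (\det _).
by apply/matrixP=> i j; rewrite !mxE.
Qed.

End Herm.

(** * The convolution inverse *)

Section Dual.
Variable C : numClosedFieldType.

(** The coefficients of [exp (-2xt + t^2)], the inverse of the generating
    function of [nhermite]. *)
Definition dual_nhermite n : {poly C} :=
  (- 'i) ^+ n *: (nhermite C n \Po (- 'i *: 'X)).

Lemma dual_nhermite_rec n : n%:R * dual_nhermite n =
  - (2%:R *: 'X) * shift dual_nhermite n - (- 2%:R) * shift (shift dual_nhermite) n.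
Proof.
have i2 : 'i * 'i = -1 :> C by rewrite -expr2 sqrCi.
(* Since [i * (- i) = 1], the power of [- i] can be raised by one, which matches
   the index shifts in the recurrence. *)
have twist (h : nat -> {poly C}) m :
    (- 'i) ^+ m *: (h m \Po (- 'i *: 'X)) =
    'i *: ((- 'i) ^+ m.+1 *: (h m \Po (- 'i *: 'X))).
  by rewrite scalerA exprS mulrA mulrN i2 opprK mul1r.
have sh1 m : shift dual_nhermite m =
    'i *: ((- 'i) ^+ m *: (shift (nhermite C) m \Po (- 'i *: 'X))).
  by case: m => [|m]; rewrite /= ?rmorph0 ?scaler0 // -twist.
have -> : shift (shift dual_nhermite) n =
    - ((- 'i) ^+ n *: (shift (shift (nhermite C)) n \Po (- 'i *: 'X))).
  case: n => [|n]; first by rewrite /= rmorph0 scaler0 oppr0.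
  by rewrite /= sh1 twist scalerA i2 scaleN1r.
rewrite sh1 /dual_nhermite -scalerAr.
have -> : n%:R * (nhermite C n \Po (- 'i *: 'X)) = (n%:R * nhermite C n) \Po (- 'i *: 'X).
  by rewrite rmorphM rmorph_nat.
rewrite nhermite_rec rmorphD !rmorphM /= linearZ /= comp_polyX rmorphN rmorph_nat.
rewrite -!mul_polyC polyCN; ring.
Qed.

Lemma nhermite_convolution n :
  convolution (nhermite C) dual_nhermite n = (n == 0%N)%:R.
Proof.
case: n => [|n].
  by rewrite /convolution big_ord1 /dual_nhermite !nhermite0 mul1r expr0 scale1r rmorph1.
have /eqP := convolution_eq0 _ _ _ _ _ n.+1 (nhermite_rec C) dual_nhermite_rec.
by rewrite mulf_eq0 -polyC_natr polyC_eq0 pnatr_eq0 => /eqP.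
Qed.

(** As [g_(j - i)] is [h_(j - i)(-ix)] times [(-i)^j / (-i)^i],
    the powers of [- i] can be extracted from rows and columns. *)
Lemma dual_nhermite_minor (s : seq nat) :
  \det (\matrix_(i < size s, j < size s) toeplitz dual_nhermite i (nth 0%N s j)) =
  ((- 'i) ^+ (\sum_(f <- s) f) / (- 'i) ^+ 'C(size s, 2)) *:
   (\det (\matrix_(i < size s, j < size s) toeplitz (nhermite C) i (nth 0%N s j))
     \Po (- 'i *: 'X)).
Proof.
have i_neq0 : (- 'i : C) != 0 by rewrite oppr_eq0 neq0Ci.
rewrite -(det_map_mx (comp_poly (- 'i *: 'X))).
set q := - 'i *: 'X.
have -> : \matrix_(i < size s, j < size s) toeplitz dual_nhermite i (nth 0%N s j) =
  \matrix_(i < size s, j < size s) ((((- 'i) ^+ i)^-1)%:P *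
     (toeplitz (nhermite C) i (nth 0%N s j) \Po q) * ((- 'i) ^+ nth 0%N s j)%:P).
  apply/matrixP=> i j; rewrite !mxE /toeplitz mulrC mulrA -polyCM.
  case: leqP => [ij|_]; last by rewrite comp_poly0 mulr0.
  by rewrite -expfB_cond ?(negbTE i_neq0) // mul_polyC.
rewrite (det_scale _ _ (fun i => (((- 'i) ^+ i)^-1)%:P)
  (fun j => ((- 'i) ^+ nth 0%N s j)%:P)
  (fun i j => toeplitz (nhermite C) i (nth 0%N s j) \Po q)).
have -> : \prod_(j < size s) ((- 'i) ^+ nth 0%N s j)%:P =
    ((- 'i) ^+ (\sum_(f <- s) f))%:P :> {poly C}.
  by rewrite -rmorph_prod -expr_sum (big_nth 0%N) big_mkord.
have -> : \prod_(i < size s) (((- 'i) ^+ i)^-1)%:P =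
    ((- 'i) ^+ 'C(size s, 2))^-1%:P :> {poly C}.
  by rewrite -rmorph_prod prodfV -expr_sum -bin2_sum big_mkord.
rewrite -polyCM mul_polyC [X in X *: _]mulrC; congr (_ *: \det _).
by apply/matrixP=> i j; rewrite !mxE.
Qed.

End Dual.

(** * The involution on finite sets *)

Lemma perm_increasing_enum F : perm_eq (increasing_enum F) F.
Proof. by rewrite /increasing_enum perm_sort. Qed.

Lemma increasing_enumP (F : {fset nat}) (s : seq nat) :
  sorted ltn s -> s =i F -> increasing_enum F = s.
Proof.
move=> s_sorted sF; apply: (irr_sorted_eq ltn_trans ltnn) => //.
  rewrite ltn_sorted_uniq_leq sort_uniq fset_uniq /=.
  exact: (sort_sorted leq_total).
by move=> x; rewrite mem_sort sF.
Qed.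

Lemma increasing_enum_filter (F : {fset nat}) :
  increasing_enum F = [seq f <- iota 0 (succ_max F) | f \in F].
Proof.
apply: increasing_enumP.
  by rewrite sorted_filter ?iota_ltn_sorted //; exact: ltn_trans.
move=> f; rewrite mem_filter mem_iota /= add0n andb_idr // => fF.
by rewrite /succ_max (bigop.leq_bigmax_seq f).
Qed.

(** Reflecting in [0, ..., max F] commutes with complementation and reverses the
    order. *)
Lemma increasing_enum_involution (F : {fset nat}) :
  increasing_enum (involution F) =
  rev [seq (succ_max F - g.+1)%N | g <- iota 0 (succ_max F) & g \notin F].
Proof.
set N := succ_max F.
apply: increasing_enumP.
  rewrite rev_sorted.
  apply: (@homo_sorted_in _ _ (gtn N) _ ltn); first by move=> x y; rewrite !inE; lia.
    by apply/allP=> g; rewrite mem_filter mem_iota /=; lia.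
  by rewrite sorted_filter ?iota_ltn_sorted //; exact: ltn_trans.
move=> m; rewrite mem_rev /involution -/N inE /= ?in_fset /=.
rewrite mem_iota add0n.
apply/mapP/andP => [[g]|[mF /= mN]].
  rewrite mem_filter mem_iota => /andP[gF gN] ->; split; last by lia.
  apply: contra gF => /imfsetP[f /= fF e].
  suff -> : g = f by [].
  have : (f < N)%N by rewrite /N /succ_max (bigop.leq_bigmax_seq f).
  by lia.
exists (N - m.+1)%N; last by lia.
rewrite mem_filter mem_iota; apply/andP; split; last by lia.
by apply: contra mF => h; apply/imfsetP; exists (N - m.+1)%N => //=; lia.
Qed.

Lemma weightE F : weight F =
  (\sum_(f <- increasing_enum F) f)%N%:Z - 'C(size (increasing_enum F), 2)%:Z.
Proof.
rewrite /weight (perm_big _ (perm_increasing_enum F)) (perm_size (perm_increasing_enum F)).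
by rewrite cardfE.
Qed.

(** With [k] elements in [F] and [m] outside of it below [N = k + m], the sum over
    the involution is [m (N - 1)] minus the sum of the elements outside [F], and
    the latter is ['C(N, 2)] minus the sum over [F]; then
    ['C(k + m, 2) = 'C(k, 2) + 'C(m, 2) + k m] leaves equal weights. *)
Lemma weight_involution F : weight (involution F) = weight F.
Proof.
rewrite !weightE increasing_enum_involution increasing_enum_filter.
set N := succ_max F; set t := filter _ _; set s := filter _ _.
have size_st : (size s + size t)%N = N.
  by rewrite !size_filter -[RHS](size_iota 0) -(count_predC [in F]).
have sum_st : (\sum_(f <- s) f + \sum_(g <- t) g = 'C(N, 2))%N.
  rewrite -big_cat /= (perm_big (iota 0 N)) ?(perm_filterC [in F]) //.
  by rewrite -bin2_sum /index_iota subn0.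
have sum_rev : (\sum_(m <- rev [seq N - g.+1 | g <- t]) m + \sum_(g <- t) g + size t
    = size t * N)%N.
  rewrite (perm_big [seq N - g.+1 | g <- t]%N) ?perm_rev // big_map.
  rewrite -sum1_size -!big_split big_distrl /= !big_seq; apply: eq_bigr => g.
  by rewrite mem_filter mem_iota; lia.
rewrite size_rev size_map.
have bin2D k m : 'C(k + m, 2) = ('C(k, 2) + 'C(m, 2) + k * m)%N.
  elim: m => [|m IHm]; first by rewrite [in RHS](bin_small (ltn0Sn 1)) muln0 !addn0.
  by rewrite addnS !binS !bin1 IHm; lia.
have bin2_double m : ('C(m, 2).*2 + m = m * m)%N.
  by elim: m => // m IHm; rewrite binS bin1; lia.
move: sum_st sum_rev (bin2_double (size t)).
rewrite -size_st bin2D mulnDr [(size t * size s)%N]mulnC.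
move: (\sum_(f <- rev _) f)%N (\sum_(f <- s) f)%N (\sum_(f <- t) f)%N => a b c.
move: (size s) (size t) => k m.
lia.
Qed.

(** * The Wronskian identity *)

(** Toeplitz matrices are symmetric about the antidiagonal. *)
Lemma toeplitz_reflect (R : comNzRingType) (h : nat -> R) n i g :
  (i < n)%N -> (g < n)%N -> toeplitz h i (n - g.+1)%N = toeplitz h g (n - i.+1)%N.
Proof.
move=> i_lt g_lt; rewrite /toeplitz.
have -> : (i <= n - g.+1)%N = (g <= n - i.+1)%N by lia.
by case: ifP => // _; congr h; lia.
Qed.

Theorem theorem1p2 (C : numClosedFieldType) (F : {fset nat}) :
  normalized_wronskian C F =
  ('i ^ weight F) *: (normalized_wronskian C (involution F) \Po ((- 'i) *: 'X)).
Proof.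
have i_neq0 : (- 'i : C) != 0 by rewrite oppr_eq0 neq0Ci.
have -> : 'i ^ weight F = (-1) ^+ (\sum_(f <- increasing_enum F) f
    + 'C(size (increasing_enum F), 2)) * (- 'i : C) ^ weight F.
  have {1}-> : 'i = -1 * - 'i :> C by rewrite mulN1r opprK.
  rewrite expfzMl weightE [X in X * _]expfzDr ?oppr_eq0 ?oner_eq0 // -exprz_inv invrN1.
  by rewrite -!exprnP -exprD.
rewrite -(weight_involution F) !normalized_wronskianE weightE.
rewrite expfzDr // -exprnP -invr_expz -exprnP.
rewrite -scalerA -dual_nhermite_minor.
set N := succ_max F.
rewrite increasing_enum_involution (increasing_enum_filter F) -/N.
(* The signs [(-1)^w] agree; it remains to identify the two minors of the
   inverse by reflecting and transposing one of them. *)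
apply: (etrans (dual_toeplitz_minor _ _ _ [in F] N (nhermite_convolution C) (nhermite0 C))).
set t := filter (predC _) _.
rewrite -mul_polyC polyC_exp polyCN; congr (_ * _).
set s := filter _ _.
have size_st : (@size nat s + @size nat t)%N = N.
  by rewrite !size_filter -[RHS](size_iota 0) -(count_predC [in F]).
rewrite -det_tr size_rev size_map.
rewrite -[RHS](det_rev _ _ (fun i j => toeplitz (dual_nhermite C) i
  (nth 0%N (rev [seq (N - g.+1)%N | g <- t]) j))); congr (\det _).
apply/matrixP=> i j; rewrite !mxE nth_rev ?size_map; last by have := ltn_ord j; lia.
have := ltn_ord i; have := ltn_ord j => jt it.
have -> : (size t - (size t - j.+1).+1)%N = j by lia.
have g_lt : (nth 0%N t j < N)%N.
  by have := mem_nth 0%N jt; rewrite mem_filter => /andP[_]; rewrite mem_iota add0n.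
rewrite (nth_map 0%N) // toeplitz_reflect //; last by rewrite -size_st; lia.
by congr (toeplitz _ _ _); rewrite -size_st; lia.
Qed.
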